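(* Let $\alpha,a\in\mathbb{R}$. The generating function $Q(x,y;\alpha,-a)$ satisfies the partial differential equation $$\frac{\partial Q(x,y;\alpha,-a)}{\partial y}=\frac{\sigma(x)\,Q(x,y;\alpha,-a)}{1+[x+y\sigma(x)]^2}\,Q^{(\alpha,-a)}_1(x+y\sigma(x)).$$
   Context: Throughout $x$ is a real variable, $\alpha,a$ are real parameters, $\sigma(x)=1+x^2$, and $\cot^{-1}:\mathbb{R}\to(0,\pi)$ is the smooth branch, so that $\frac{d}{dx}\cot^{-1}x=-1/\sigma(x)$. For integers $l\ge 0$ put $w_l(x)=\sigma(x)^{-(l+a+1)}e^{-\alpha\cot^{-1}x}=\sigma(x)^{-l}w_0(x)$. Define $P_l^{(a,\alpha)}(x)=\frac{1}{w_l(x)}\frac{d^l}{dx^l}[w_l(x)\sigma(x)^l]=\frac{\sigma(x)^l}{w_0(x)}\frac{d^l w_0(x)}{dx^l}$. The complementary (Romanovski) polynomials $Q_\nu^{(\alpha,-a)}$, with $Q_0^{(\alpha,-a)}\equiv 1$, are defined by the Rodrigues representation $P_l^{(a,\alpha)}(x)=\frac{1}{w_l(x)}\frac{d^{l-\nu}}{dx^{l-\nu}}[\sigma(x)^{l-\nu}w_l(x)Q_\nu^{(\alpha,-a)}(x)]$ for all integers $0\le\nu\le l$ (the case $l=\nu$ reads $Q_\nu^{(\alpha,-a)}=P_\nu^{(a,\alpha)}$). The second upper index is minus the parameter $a$ of the weight. The generating function is defined as $Q(x,y;\alpha,-a)=\sum_{\nu=0}^{\infty}\frac{y^{\nu}}{\nu!}Q^{(\alpha,-a)}_{\nu}(x)$,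 and is summed in the closed form $Q(x,y;\alpha,-a)=(1+x^2)^{a+1}e^{\alpha\cot^{-1}x}[1+(x+y(1+x^2))^2]^{-(a+1)}e^{-\alpha\cot^{-1}(x+y(1+x^2))}$. *)

(* Defs.v *)
From Stdlib Require Import Arith Reals Lra Lia.
From Coquelicot Require Import Coquelicot.
Open Scope R_scope.

Definition rsigma (x : R) : R := 1 + x ^ 2.

(* The smooth branch R -> (0, PI), with derivative - / rsigma. *)
Definition arccot (x : R) : R := PI / 2 - atan x.

Definition weight (alpha a : R) (l : nat) (x : R) : R :=
  Rpower (rsigma x) (- (INR l + a + 1)) * exp (- alpha * arccot x).

Definition romanovskiP (alpha a : R) (l : nat) (x : R) : R :=
  / weight alpha a l x *
  Derive_n (fun t => weight alpha a l t * rsigma t ^ l) l x.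

(* [Q nu] is Q_nu^(alpha, -a): the parameter [a] here is that of the weight,
   i.e. minus the second upper index. The case l = nu determines [Q]. *)
Definition is_complementary_romanovski (alpha a : R) (Q : nat -> R -> R) : Prop :=
  (forall x, Q 0%nat x = 1) /\
  (forall (nu l : nat) (x : R), (nu <= l)%nat ->
     romanovskiP alpha a l x =
     / weight alpha a l x *
     Derive_n (fun t => rsigma t ^ (l - nu) * weight alpha a l t * Q nu t)
              (l - nu) x).

Definition genQ_coef (Q : nat -> R -> R) (x : R) (nu : nat) : R :=
  Q nu x / INR (fact nu).

(* Equal to its defining series only where the latter converges; the sum is a
   power series in [y] for fixed [x]. *)
Definition genQ (Q : nat -> R -> R) (x y : R) : R := PSeries (genQ_coef Q x) y.

Definition genQ_closed (alpha a x y : R) : R :=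
  Rpower (1 + x ^ 2) (a + 1) * exp (alpha * arccot x) *
  Rpower (1 + (x + y * (1 + x ^ 2)) ^ 2) (- (a + 1)) *
  exp (- alpha * arccot (x + y * (1 + x ^ 2))).

Lemma rsigma_gt0 (x : R) : 0 < rsigma x.
Proof. unfold rsigma; nra. Qed.

Lemma weight_neq0 (alpha a : R) (l : nat) (x : R) : weight alpha a l x <> 0.
Proof.
  unfold weight, Rpower.
  apply Rmult_integral_contrapositive_currified;
    apply Rgt_not_eq, exp_pos.
Qed.

Lemma weight_rsigma (alpha a : R) (l : nat) (x : R) :
  weight alpha a l x * rsigma x ^ l = weight alpha a 0 x.
Proof.
  unfold weight.
  rewrite <- (Rpower_pow l (rsigma x) (rsigma_gt0 x)).
  replace (- (INR 0 + a + 1)) with (- (INR l + a + 1) + INR l) by (simpl; ring).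
  rewrite Rpower_plus; ring.
Qed.

(* The defining system of the complementary polynomials is consistent. *)
Lemma complementary_romanovski_exists (alpha a : R) :
  is_complementary_romanovski alpha a (romanovskiP alpha a).
Proof.
  assert (HP : forall l x, weight alpha a l x * romanovskiP alpha a l x
                           = Derive_n (weight alpha a 0) l x).
  { intros l x; unfold romanovskiP.
    rewrite <- Rmult_assoc, Rinv_r, Rmult_1_l by apply weight_neq0.
    apply Derive_n_ext; intros t; apply weight_rsigma. }
  split.
  - intros x.
    apply (Rmult_eq_reg_l (weight alpha a 0 x)); [|apply weight_neq0].
    rewrite HP; simpl; ring.
  - intros nu l x Hle.
    apply (Rmult_eq_reg_l (weight alpha a l x)); [|apply weight_neq0].
    rewrite HP, <- Rmult_assoc, Rinv_r, Rmult_1_l by apply weight_neq0.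
    transitivity (Derive_n (Derive_n (weight alpha a 0) nu) (l - nu) x).
    + rewrite Derive_n_comp; f_equal; lia.
    + apply Derive_n_ext; intros t.
      rewrite <- HP; f_equal.
      apply (Rmult_eq_reg_r (rsigma t ^ nu));
        [|apply pow_nonzero, Rgt_not_eq, rsigma_gt0].
      rewrite weight_rsigma, <- (weight_rsigma alpha a l t).
      replace (rsigma t ^ l) with (rsigma t ^ (l - nu) * rsigma t ^ nu)
        by (rewrite <- pow_add; f_equal; lia).
      ring.
Qed.

(* Main.v *)
Require Import Defs.
From Stdlib Require Import Arith Reals Lra Lia.
From Coquelicot Require Import Coquelicot.
Open Scope R_scope.

(** The closed form is [w (x + y * rsigma x) / w x], where [w] is the weight
    with [l = 0], so everything is governed by the Pearson equation
    [rsigma * w' = (alpha - 2 (a + 1) x) * w] (lemma [is_derive_weight0]).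

    With [z = x + y * rsigma x], one has
    [1 + z ^ 2 = rsigma x * (1 + 2 x y + rsigma x * y ^ 2)].  As
    [Q 1 z = alpha - 2 (a + 1) z], the partial differential equation is, for
    fixed [x], the linear equation in [y]
    [(1 + 2 x y + rsigma x * y ^ 2) * h' = Q 1 z * h].
    The closed form solves it by the chain rule ([is_derive_genQ_closed]).

    For the series, differentiating the Pearson equation repeatedly shows that
    [w^(n) = w * q n / rsigma ^ n] with polynomials [q n] obeying a three-term
    recurrence ([romanovski_rec], [Derive_n_weight0]), and the Rodrigues
    representation with [l = nu] identifies [Q n] with [q n]
    ([complementary_romanovski_unique]).  Divided by factorials, the recurrence
    has bounded coefficients.  This bounds [Q n x / n!] by a geometric sequence,
    so that the radius of convergence is positive ([CV_radius_romanovski_gt0]),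
    and it says exactly that the sum of the series solves the same linear
    equation ([romanovski_series_ode]).  The leading coefficient
    [(1 + z ^ 2) / rsigma x] never vanishes, so the series and the closed form,
    both equal to [1] at [y = 0], agree on the whole interval of convergence
    ([romanovski_series_closed]). *)

(** * The weight and the closed form *)

(** This is also [Q 1], and the logarithmic derivative of the weight times
    [rsigma]. *)
Definition pearson (alpha a x : R) : R := alpha - 2 * (a + 1) * x.

Lemma is_derive_weight0 (alpha a x : R) :
  is_derive (weight alpha a 0) x
    (weight alpha a 0 x * pearson alpha a x / rsigma x).
Proof.
  pose proof (rsigma_gt0 x) as Hs.
  unfold weight, Rpower, arccot, pearson, rsigma in *.
  auto_derive; [lra|].
  change (x * (x * 1)) with (x ^ 2).
  change (PI / 2 + - atan x) with (PI / 2 - atan x).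
  simpl INR; field; lra.
Qed.

Lemma weight_gt0 (alpha a : R) (l : nat) (x : R) : 0 < weight alpha a l x.
Proof. apply Rmult_lt_0_compat; apply exp_pos. Qed.

Lemma genQ_closed_weight (alpha a x y : R) :
  genQ_closed alpha a x y =
  weight alpha a 0 (x + y * rsigma x) / weight alpha a 0 x.
Proof.
  unfold genQ_closed, weight; fold (rsigma x); fold (rsigma (x + y * rsigma x)).
  simpl INR; rewrite Rplus_0_l, Rpower_Ropp with (x := rsigma x).
  replace (- alpha * arccot x) with (- (alpha * arccot x)) by ring.
  rewrite exp_Ropp.
  field; split; apply Rgt_not_eq, exp_pos.
Qed.

Lemma genQ_closed_gt0 (alpha a x y : R) : 0 < genQ_closed alpha a x y.
Proof.
  rewrite genQ_closed_weight.
  apply Rdiv_lt_0_compat; apply weight_gt0.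
Qed.

Lemma genQ_closed_0 (alpha a x : R) : genQ_closed alpha a x 0 = 1.
Proof.
  rewrite genQ_closed_weight, Rmult_0_l, Rplus_0_r.
  apply Rinv_r, weight_neq0.
Qed.

Lemma is_derive_genQ_closed (alpha a x y : R) :
  is_derive (genQ_closed alpha a x) y
    (rsigma x * genQ_closed alpha a x y / (1 + (x + y * rsigma x) ^ 2)
     * pearson alpha a (x + y * rsigma x)).
Proof.
  pose proof (rsigma_gt0 (x + y * rsigma x)) as Hz.
  pose proof (weight_neq0 alpha a 0 x) as Hw.
  apply (is_derive_ext (fun t =>
    / weight alpha a 0 x * weight alpha a 0 (x + t * rsigma x)));
    [intros t; rewrite genQ_closed_weight; apply Rmult_comm|].
  evar_last.
  - apply is_derive_scal.
    apply (is_derive_comp (weight alpha a 0) (fun t => x + t * rsigma x)).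
    + apply is_derive_weight0.
    + auto_derive; [exact I | reflexivity].
  - rewrite genQ_closed_weight.
    unfold scal; simpl; unfold mult; simpl.
    set (z := x + y * rsigma x) in *.
    replace (1 + z * (z * 1)) with (rsigma z) by (unfold rsigma; ring).
    field; split; [exact Hw | lra].
Qed.

(** * The complementary polynomials by recurrence *)

(** The recurrence is the Leibniz rule applied to the [n]-th derivative of the
    Pearson equation, of which only three terms survive because [rsigma] is
    quadratic, rescaled by [rsigma ^ n / w]. *)
Fixpoint romanovski_rec (alpha a : R) (n : nat) (x : R) : R :=
  match n with
  | 0%nat => 1
  | S 0 => pearson alpha a x
  | S (S k as m) =>
      (pearson alpha a x - 2 * INR m * x) * romanovski_rec alpha a m x
      - INR m * (INR k + 2 * (a + 1)) * rsigma x * romanovski_rec alpha a k x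
  end.

Lemma romanovski_rec_SS (alpha a : R) (n : nat) (x : R) :
  romanovski_rec alpha a (S (S n)) x =
  (pearson alpha a x - 2 * INR (S n) * x) * romanovski_rec alpha a (S n) x
  - INR (S n) * (INR n + 2 * (a + 1)) * rsigma x * romanovski_rec alpha a n x.
Proof. reflexivity. Qed.

(** Differentiation lowers the index, with the same factor that multiplies
    [rsigma] in the recurrence: this is what turns the derivative of
    [w * q n / rsigma ^ n] back into the recurrence. *)
Lemma is_derive_romanovski_rec (alpha a : R) (n : nat) (x : R) :
  is_derive (romanovski_rec alpha a (S n)) x
    (- (INR (S n) * (INR n + 2 * (a + 1))) * romanovski_rec alpha a n x).
Proof.
  revert x.
  (* The recurrence has two steps, hence the induction on consecutive pairs. *)
  enough (H : forall m,
    (forall x, is_derive (romanovski_rec alpha a (S m)) x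
      (- (INR (S m) * (INR m + 2 * (a + 1))) * romanovski_rec alpha a m x)) /\
    (forall x, is_derive (romanovski_rec alpha a (S (S m))) x
      (- (INR (S (S m)) * (INR (S m) + 2 * (a + 1)))
       * romanovski_rec alpha a (S m) x))) by apply H.
  assert (H1 : forall x, is_derive (romanovski_rec alpha a 1) x
                 (- (INR 1 * (INR 0 + 2 * (a + 1))) * romanovski_rec alpha a 0 x)).
  { intros x; simpl; unfold pearson; auto_derive; [exact I | ring]. }
  induction m as [|m [IH0 IH1]]; split.
  - exact H1.
  - intros x; simpl; unfold pearson, rsigma; auto_derive; [exact I | ring].
  - exact IH1.
  - intros x.
    apply (is_derive_ext (fun t =>
      (pearson alpha a t - 2 * INR (S (S m)) * t)
        * romanovski_rec alpha a (S (S m)) t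
      - INR (S (S m)) * (INR (S m) + 2 * (a + 1)) * rsigma t
        * romanovski_rec alpha a (S m) t)); [reflexivity|].
    pose proof (IH0 x) as Hg; pose proof (IH1 x) as Hf.
    pose proof (romanovski_rec_SS alpha a m x) as E.
    revert Hf Hg E.
    (* Kept opaque, since differentiation would unfold the recursion. *)
    generalize (romanovski_rec alpha a (S (S m))) (romanovski_rec alpha a (S m)).
    intros f g Hf Hg E.
    unfold pearson at 1, rsigma at 1.
    set (b1 := INR (S (S m))) in *; set (b0 := INR (S m)) in *.
    auto_derive.
    + repeat split; eexists; eassumption.
    + rewrite (is_derive_unique (fun t : R => f t) x _ Hf).
      rewrite (is_derive_unique (fun t : R => g t) x _ Hg), E.
      unfold pearson, rsigma, b1, b0; rewrite !S_INR; ring.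
Qed.

Lemma is_derive_weight0_romanovski_rec (alpha a : R) (n : nat) (x : R) :
  is_derive
    (fun t => weight alpha a 0 t * romanovski_rec alpha a n t / rsigma t ^ n) x
    (weight alpha a 0 x * romanovski_rec alpha a (S n) x / rsigma x ^ (S n)).
Proof.
  pose proof (rsigma_gt0 x) as Hs.
  pose proof (is_derive_weight0 alpha a x) as Hw.
  destruct n as [|n].
  - apply (is_derive_ext (weight alpha a 0)); [intros t; simpl; field|].
    evar_last; [exact Hw | simpl; field; lra].
  - pose proof (is_derive_romanovski_rec alpha a n x) as Hq.
    assert (Hsn : is_derive (fun t => rsigma t ^ S n) x
                    (INR (S n) * (2 * x) * rsigma x ^ n)).
    { unfold rsigma; auto_derive; [exact I|].
      change (Nat.pred (S n)) with n; simpl; ring. }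
    assert (Hp : rsigma x ^ n <> 0) by (apply pow_nonzero; lra).
    evar_last.
    + apply (is_derive_div
        (fun t => weight alpha a 0 t * romanovski_rec alpha a (S n) t)
        (fun t => rsigma t ^ S n)).
      * apply (is_derive_mult (weight alpha a 0) (romanovski_rec alpha a (S n)));
          [exact Hw | exact Hq | intros u v; apply Rmult_comm].
      * exact Hsn.
      * apply pow_nonzero; lra.
    + rewrite romanovski_rec_SS.
      unfold plus, mult; simpl.
      field; repeat split; try assumption; lra.
Qed.

Lemma Derive_n_weight0 (alpha a : R) (n : nat) (x : R) :
  Derive_n (weight alpha a 0) n x =
  weight alpha a 0 x * romanovski_rec alpha a n x / rsigma x ^ n.
Proof.
  revert x; induction n as [|n IH]; intros x.
  - simpl; field.
  - simpl Derive_n.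
    rewrite (Derive_ext _ _ x IH).
    apply is_derive_unique, is_derive_weight0_romanovski_rec.
Qed.

Lemma complementary_romanovski_unique (alpha a : R) (Q : nat -> R -> R) :
  is_complementary_romanovski alpha a Q ->
  forall n x, Q n x = romanovski_rec alpha a n x.
Proof.
  intros [_ HQ] n x.
  pose proof (HQ n n x (Nat.le_refl n)) as H.
  rewrite Nat.sub_diag in H; simpl in H.
  unfold romanovskiP in H.
  rewrite (Derive_n_ext _ _ n x (weight_rsigma alpha a n)) in H.
  rewrite Derive_n_weight0, <- (weight_rsigma alpha a n) in H.
  pose proof (weight_neq0 alpha a n x) as Hw.
  assert (Hs : rsigma x ^ n <> 0)
    by (apply pow_nonzero, Rgt_not_eq, rsigma_gt0).
  transitivity (/ weight alpha a n x * (1 * weight alpha a n x * Q n x));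
    [field; exact Hw|].
  rewrite <- H; field; split; assumption.
Qed.

(** * The power series in [y] *)

Lemma genQ_coef_SS (alpha a x : R) (n : nat) :
  let c := genQ_coef (romanovski_rec alpha a) x in
  INR (S (S n)) * c (S (S n)) =
  (pearson alpha a x - 2 * INR (S n) * x) * c (S n)
  - (INR n + 2 * (a + 1)) * rsigma x * c n.
Proof.
  unfold genQ_coef; cbv zeta.
  rewrite romanovski_rec_SS.
  rewrite !fact_simpl, !mult_INR.
  pose proof (INR_fact_neq_0 n).
  pose proof (not_0_INR (S n) (Nat.neq_succ_0 n)).
  pose proof (not_0_INR (S (S n)) (Nat.neq_succ_0 (S n))).
  field; auto.
Qed.

(** Solved for [c (n + 2)], the recurrence has coefficients bounded in [n],
    because the factor [n + 2] on the left absorbs their linear growth. *)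
Lemma genQ_coef_geometric (alpha a x : R) :
  exists K, 1 <= K /\
    forall n, Rabs (genQ_coef (romanovski_rec alpha a) x n) <= K ^ n.
Proof.
  set (c := genQ_coef (romanovski_rec alpha a) x).
  set (M := Rabs (pearson alpha a x) + 2 * Rabs x
            + (1 + Rabs (2 * (a + 1))) * rsigma x).
  pose proof (rsigma_gt0 x) as Hs.
  pose proof (Rabs_pos (pearson alpha a x)) as Hp0.
  pose proof (Rabs_pos x) as Hx0.
  pose proof (Rabs_pos (2 * (a + 1))) as Ha0.
  assert (HM0 : 0 <= M).
  { unfold M; nra. }
  assert (Hstep : forall n,
    Rabs (c (S (S n))) <= M * Rabs (c (S n)) + M * Rabs (c n)).
  { intros n.
    pose proof (genQ_coef_SS alpha a x n) as E; cbv zeta in E; fold c in E.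
    pose proof (pos_INR n) as Hn.
    rewrite !S_INR in E.
    apply (Rmult_le_reg_l (INR n + 1 + 1)); [lra|].
    rewrite <- (Rabs_pos_eq (INR n + 1 + 1)) at 1 by lra.
    rewrite <- Rabs_mult, E.
    eapply Rle_trans; [apply Rabs_triang|].
    rewrite Rabs_Ropp, !Rabs_mult, (Rabs_pos_eq (rsigma x)) by lra.
    rewrite (Rmult_plus_distr_l (INR n + 1 + 1)), <- !(Rmult_assoc (INR n + 1 + 1)).
    apply Rplus_le_compat; apply Rmult_le_compat_r; try apply Rabs_pos.
    - eapply Rle_trans; [apply Rabs_triang|].
      rewrite Rabs_Ropp, !Rabs_mult, (Rabs_pos_eq 2), (Rabs_pos_eq (INR n + 1))
        by lra.
      assert (0 <= (1 + Rabs (2 * (a + 1))) * rsigma x)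
        by (apply Rmult_le_pos; lra).
      assert (0 <= INR n * Rabs (pearson alpha a x))
        by (apply Rmult_le_pos; lra).
      assert (0 <= INR n * ((1 + Rabs (2 * (a + 1))) * rsigma x))
        by (apply Rmult_le_pos; lra).
      unfold M; lra.
    - assert (Rabs (INR n + 2 * (a + 1)) <= INR n + Rabs (2 * (a + 1))).
      { eapply Rle_trans; [apply Rabs_triang|].
        rewrite (Rabs_pos_eq (INR n)); lra. }
      apply Rle_trans with ((INR n + Rabs (2 * (a + 1))) * rsigma x);
        [apply Rmult_le_compat_r; lra|].
      apply Rle_trans with
        ((INR n + 1 + 1) * ((1 + Rabs (2 * (a + 1))) * rsigma x)).
      + rewrite <- Rmult_assoc; apply Rmult_le_compat_r; nra.
      + apply Rmult_le_compat_l; unfold M; lra. }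
  (* [M * (K ^ (n + 1) + K ^ n) <= K ^ (n + 2)] as soon as [1, 2 * M <= K]. *)
  exists (2 * M + 1); split; [lra|].
  enough (H : forall n, Rabs (c n) <= (2 * M + 1) ^ n /\
                        Rabs (c (S n)) <= (2 * M + 1) ^ S n) by apply H.
  induction n as [|n [IH0 IH1]]; split.
  - unfold c, genQ_coef; simpl.
    replace (1 / 1) with 1 by field; rewrite Rabs_R1; lra.
  - unfold c, genQ_coef; simpl.
    replace (pearson alpha a x / 1) with (pearson alpha a x) by field.
    unfold M in *; nra.
  - exact IH1.
  - eapply Rle_trans; [apply Hstep|].
    assert (0 <= (2 * M + 1) ^ n) by (apply pow_le; lra).
    simpl in *.
    apply Rle_trans with (M * ((2 * M + 1) * (2 * M + 1) ^ n)
                          + M * (2 * M + 1) ^ n).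
    + apply Rplus_le_compat; apply Rmult_le_compat_l; assumption.
    + nra.
Qed.

Lemma CV_radius_gt0_geometric (c : nat -> R) (K : R) :
  1 <= K -> (forall n, Rabs (c n) <= K ^ n) -> Rbar_lt 0 (CV_radius c).
Proof.
  intros HK Hc.
  apply Rbar_lt_le_trans with (/ K).
  - simpl; apply Rinv_0_lt_compat; lra.
  - apply (CV_radius_bounded c).
    exists 1; intros n.
    rewrite Rabs_mult, pow_inv, Rabs_inv.
    assert (0 < K ^ n) by (apply pow_lt; lra).
    rewrite (Rabs_pos_eq (K ^ n)) by lra.
    apply (Rmult_le_reg_r (K ^ n)); [lra|].
    rewrite Rmult_assoc, Rinv_l, Rmult_1_r, Rmult_1_l by lra.
    apply Hc.
Qed.

Lemma CV_radius_romanovski_gt0 (alpha a x : R) :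
  Rbar_lt 0 (CV_radius (genQ_coef (romanovski_rec alpha a) x)).
Proof.
  destruct (genQ_coef_geometric alpha a x) as [K [HK Hc]].
  exact (CV_radius_gt0_geometric _ K HK Hc).
Qed.

(** Comparing the coefficients of [y ^ (n + 1)] gives the recurrence for the
    coefficients of the series. *)
Lemma romanovski_series_ode (alpha a x y : R) :
  let c := genQ_coef (romanovski_rec alpha a) x in
  Rbar_lt (Rabs y) (CV_radius c) ->
  (1 + 2 * x * y + rsigma x * y ^ 2) * PSeries (PS_derive c) y =
  pearson alpha a (x + y * rsigma x) * PSeries c y.
Proof.
  intros c Hy.
  assert (Hc : is_pseries c y (PSeries c y))
    by (apply PSeries_correct, CV_radius_inside, Hy).
  assert (Hd : is_pseries (PS_derive c) y (PSeries (PS_derive c) y)).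
  { apply PSeries_correct, CV_radius_inside; rewrite CV_radius_derive; exact Hy. }
  set (h := PSeries c y) in *.
  set (h' := PSeries (PS_derive c) y) in *.
  assert (Hcomm : forall u v : R, mult u v = mult v u)
    by (intros u v; apply Rmult_comm).
  pose proof (is_pseries_incr_1 _ _ _ Hc) as Hc1.
  pose proof (is_pseries_incr_1 _ _ _ Hd) as Hd1.
  pose proof (is_pseries_incr_1 _ _ _ Hd1) as Hd2.
  pose proof (is_pseries_plus _ _ _ _ _ Hd
    (is_pseries_plus _ _ _ _ _
       (is_pseries_scal (2 * x) _ _ _ (Hcomm _ _) Hd1)
       (is_pseries_scal (rsigma x) _ _ _ (Hcomm _ _) Hd2))) as HL.
  pose proof (is_pseries_plus _ _ _ _ _
       (is_pseries_scal (pearson alpha a x) _ _ _ (Hcomm _ _) Hc)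
       (is_pseries_scal (- (2 * (a + 1) * rsigma x)) _ _ _ (Hcomm _ _) Hc1))
    as HR.
  apply is_pseries_unique in HL.
  apply is_pseries_unique in HR.
  unfold plus, scal in HL, HR; simpl in HL, HR; unfold mult in HL, HR;
    simpl in HL, HR.
  transitivity (h' + (2 * x * (y * h') + rsigma x * (y * (y * h'))));
    [ring|].
  transitivity (pearson alpha a x * h + - (2 * (a + 1) * rsigma x) * (y * h));
    [|unfold pearson; ring].
  rewrite <- HL, <- HR.
  apply PSeries_ext; intros n.
  unfold PS_plus, PS_scal, PS_incr_1, PS_derive, plus, scal, zero; simpl.
  unfold mult; simpl.
  destruct n as [|n].
  - unfold c, genQ_coef; simpl; field.
  - pose proof (genQ_coef_SS alpha a x n) as E; cbv zeta in E; fold c in E.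
    change (match n with 0%nat => 1 | S _ => INR n + 1 end) with (INR (S n)).
    change (match n with 0%nat => 1 + 1 | S _ => INR n + 1 + 1 end)
      with (INR (S (S n))) in *.
    destruct n as [|n]; simpl in *; lra.
Qed.

Lemma is_derive_romanovski_series (alpha a x y : R) :
  let c := genQ_coef (romanovski_rec alpha a) x in
  Rbar_lt (Rabs y) (CV_radius c) ->
  is_derive (PSeries c) y
    (rsigma x * PSeries c y / (1 + (x + y * rsigma x) ^ 2)
     * pearson alpha a (x + y * rsigma x)).
Proof.
  intros c Hy.
  evar_last; [apply is_derive_PSeries, Hy|].
  pose proof (romanovski_series_ode alpha a x y Hy) as E; fold c in E.
  assert (Hz : 1 + (x + y * rsigma x) ^ 2
               = rsigma x * (1 + 2 * x * y + rsigma x * y ^ 2))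
    by (unfold rsigma; ring).
  pose proof (rsigma_gt0 x) as Hs.
  assert (Hl : 0 < 1 + 2 * x * y + rsigma x * y ^ 2).
  { apply (Rmult_lt_reg_l (rsigma x)); [exact Hs|].
    rewrite <- Hz, Rmult_0_r; apply rsigma_gt0. }
  rewrite Hz.
  apply (Rmult_eq_reg_l (1 + 2 * x * y + rsigma x * y ^ 2)); [|lra].
  rewrite E; field; lra.
Qed.

(** The quotient of the sum of the series by the closed form has zero
    derivative on the segment from [0] to [y], since both solve the same linear
    equation; this reaches every [y] inside the radius of convergence. *)
Lemma romanovski_series_closed (alpha a x y : R) :
  let c := genQ_coef (romanovski_rec alpha a) x in
  Rbar_lt (Rabs y) (CV_radius c) -> PSeries c y = genQ_closed alpha a x y.
Proof.
  intros c Hy.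
  assert (Hd : forall t, Rabs t <= Rabs y ->
    is_derive (fun t => PSeries c t / genQ_closed alpha a x t) t zero).
  { intros t Ht.
    assert (Htc : Rbar_lt (Rabs t) (CV_radius c))
      by exact (Rbar_le_lt_trans (Rabs t) (Rabs y) _ Ht Hy).
    pose proof (genQ_closed_gt0 alpha a x t) as Hg.
    evar_last.
    - apply is_derive_div.
      + apply is_derive_romanovski_series, Htc.
      + apply is_derive_genQ_closed.
      + lra.
    - pose proof (rsigma_gt0 (x + t * rsigma x)) as Hz.
      fold (rsigma (x + t * rsigma x)); fold c.
      unfold zero; simpl; field; lra. }
  assert (H : PSeries c 0 / genQ_closed alpha a x 0
              = PSeries c y / genQ_closed alpha a x y).
  { destruct (Rtotal_order 0 y) as [Hlt | [<- | Hlt]]; [| reflexivity |].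
    - apply (eq_is_derive (fun t => PSeries c t / genQ_closed alpha a x t));
        [|exact Hlt].
      intros t Ht; apply Hd; rewrite !Rabs_pos_eq; lra.
    - symmetry.
      apply (eq_is_derive (fun t => PSeries c t / genQ_closed alpha a x t));
        [|exact Hlt].
      intros t Ht; apply Hd; rewrite !Rabs_left1; lra. }
  rewrite PSeries_0, genQ_closed_0 in H.
  pose proof (genQ_closed_gt0 alpha a x y) as Hg.
  assert (Hc0 : c 0%nat = 1) by (unfold c, genQ_coef; simpl; field).
  rewrite Hc0 in H.
  apply (Rmult_eq_reg_r (/ genQ_closed alpha a x y));
    [|apply Rinv_neq_0_compat; lra].
  unfold Rdiv in H; rewrite <- H; field; lra.
Qed.

Theorem theorem1p7 (alpha a : R) (Q : nat -> R -> R)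
    (HQ : is_complementary_romanovski alpha a Q) :
  (forall x : R, Rbar_lt 0 (CV_radius (genQ_coef Q x))) /\
  (forall x y : R, Rbar_lt (Rabs y) (CV_radius (genQ_coef Q x)) ->
     is_series (fun nu : nat => y ^ nu / INR (fact nu) * Q nu x)
               (genQ_closed alpha a x y) /\
     is_derive (fun t : R => genQ Q x t) y
       (rsigma x * genQ Q x y / (1 + (x + y * rsigma x) ^ 2)
        * Q 1%nat (x + y * rsigma x))) /\
  (forall x y : R,
     is_derive (fun t : R => genQ_closed alpha a x t) y
       (rsigma x * genQ_closed alpha a x y / (1 + (x + y * rsigma x) ^ 2)
        * Q 1%nat (x + y * rsigma x))).
Proof.
  pose proof (complementary_romanovski_unique alpha a Q HQ) as HQr.
  assert (Hcoef : forall x n,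
    genQ_coef Q x n = genQ_coef (romanovski_rec alpha a) x n)
    by (intros x n; unfold genQ_coef; rewrite HQr; reflexivity).
  assert (Hrad : forall x,
    CV_radius (genQ_coef Q x) = CV_radius (genQ_coef (romanovski_rec alpha a) x))
    by (intros x; apply CV_radius_ext, Hcoef).
  assert (HgenQ : forall x y,
    genQ Q x y = PSeries (genQ_coef (romanovski_rec alpha a) x) y)
    by (intros x y; apply PSeries_ext, Hcoef).
  split; [|split; [intros x y Hy; split|]].
  - intros x; rewrite Hrad; apply CV_radius_romanovski_gt0.
  - rewrite <- romanovski_series_closed by (rewrite <- Hrad; assumption).
    apply (is_series_ext (fun n =>
      scal (pow_n y n) (genQ_coef (romanovski_rec alpha a) x n))).
    + intros n.
      rewrite pow_n_pow, <- Hcoef; unfold genQ_coef, scal; simpl.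
      unfold mult; simpl; field; apply INR_fact_neq_0.
    + apply PSeries_correct, CV_radius_inside; rewrite <- Hrad; assumption.
  - rewrite HQr, HgenQ.
    apply (is_derive_ext (PSeries (genQ_coef (romanovski_rec alpha a) x)));
      [intros t; symmetry; apply HgenQ|].
    apply is_derive_romanovski_series; rewrite <- Hrad; assumption.
  - intros x y; rewrite HQr; apply is_derive_genQ_closed.
Qed.
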